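(* Let $\omega(k)$ be any sequence with $\omega(k)\to\infty$. Then with probability tending to $1$ as $k\to\infty$, $$k^2\log k-(1-\gamma)k^2-\omega(k)k^{3/2}\le X_k\le k^2\log k+\gamma k^2+\omega(k)k^{3/2}.$$
   Context: Fix $k\ge 1$. Start with the empty word and at each time step append a letter chosen independently and uniformly at random from $[k]=\{1,\ldots,k\}$. $X_k$ is the first time step at which the current word is a superpattern for all length-$k$ preferential arrangements on $[k]$, i.e. contains, as a (not necessarily contiguous) subsequence order isomorphic to it, every string of length $k$ over positive integers up to order isomorphism; equivalently, the first time the word contains every permutation of $[k]$ as a subsequence. Here $\gamma$ is Euler's constant and $\log$ is the natural logarithm. *)

(* Defs.v *)
From HB Require Import structures.
From mathcomp Require Import all_boot all_order all_algebra finmap.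
From mathcomp Require Import all_classical all_reals all_analysis.

Set Implicit Arguments.
Unset Strict Implicit.
Unset Printing Implicit Defensive.

Import Order.TTheory GRing.Theory Num.Theory.
Import numFieldNormedType.Exports.

Local Open Scope classical_set_scope.
Local Open Scope ring_scope.

Definition euler_gamma (R : realType) : R :=
  lim (((\sum_(1 <= i < n.+1) (i%:R : R)^-1) - ln n%:R) @[n --> \oo]).

Definition order_isomorphic (s t : seq nat) : Prop :=
  size s = size t /\
  forall i j, (i < size s)%N -> (j < size s)%N ->
    (nth 0%N s i < nth 0%N s j)%N = (nth 0%N t i < nth 0%N t j)%N.

Definition contains_pattern (w s : seq nat) : Prop :=
  exists2 u, subseq u w & order_isomorphic u s.

(* Ties are allowed in [s]: up to order isomorphism, the strings of length [k]
   over the positive integers are the length-[k] preferential arrangements. *)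
Definition superpattern (k : nat) (w : seq nat) : Prop :=
  forall s : seq nat, size s = k -> all (leq 1) s -> contains_pattern w s.

(* [w i] is the letter appended at step [i.+1]; the value is [+oo] when no
   prefix of [w] is a superpattern. *)
Definition superpattern_time (R : realType) (k : nat) (w : nat -> nat) :
    \bar R :=
  ereal_inf [set n%:R%:E | n in [set n | superpattern k (mkseq w n)]].

Definition mutually_independent (d : measure_display) (T : measurableType d)
    (R : realType) (P : probability T R) (d' : measure_display)
    (T' : measurableType d') (I : choiceType) (X : I -> {RV P >-> T'}) : Prop :=
  forall (J : {fset I}) (A : I -> set T'),
    (forall i, i \in J -> measurable (A i)) ->
    P (\bigcap_(i in [set` J]) X i @^-1` A i) =
    (\prod_(i <- J) P (X i @^-1` A i))%E.

(* The [k] point masses add up to 1, so [X] lies in {1, ..., k} almost surely. *)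
Definition uniform_letter (d : measure_display) (T : measurableType d)
    (R : realType) (P : probability T R) (k : nat) (X : {RV P >-> nat}) : Prop :=
  forall a : nat, (1 <= a <= k)%N -> P (X @^-1` [set a]) = ((k%:R)^-1)%:E.

Definition iid_uniform_letters (d : measure_display) (T : measurableType d)
    (R : realType) (P : probability T R) (k : nat)
    (X : nat -> {RV P >-> nat}) : Prop :=
  mutually_independent X /\ forall n, uniform_letter k (X n).

(* Main.v *)
(* Cut the random word greedily into successive complete collections of the
   alphabet. After k of them every word of length k over [k] has occurred as a
   subsequence. Conversely, an adversary builds a permutation by always asking
   next for the remaining letter that shows up last, so that containing every
   permutation forces collections of k, k - 1, ..., 1 letters one after the
   other. Both times are sums of independent geometric variables, with means
   k^2 H_k and k ((k + 1) H_k - k) and variances at most 2 k^3, and Chebyshev's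
   inequality concludes. It is obtained without stopping times: for a constant
   e, with n letters still to be read and mu and v the mean and variance bound
   of the remaining time, v + (mu + e - n)^2 is a supermartingale. *)
Require Import Defs.
From mathcomp Require Import all_boot all_order all_algebra.
From mathcomp Require Import all_classical all_reals all_analysis.
From mathcomp Require Import finmap measurable_realfun ring lra.

Set Implicit Arguments.
Unset Strict Implicit.
Unset Printing Implicit Defensive.

Import Order.TTheory GRing.Theory Num.Theory.
Import numFieldNormedType.Exports.

Local Open Scope classical_set_scope.
Local Open Scope ring_scope.

Definition rank (s : seq nat) (x : nat) : nat := count (fun y => (y < x)%N) s.

Lemma leq_rank (s : seq nat) (x y : nat) :
  (x <= y)%N -> (rank s x <= rank s y)%N.
Proof. by move=> xy; apply: sub_count => z /= /leq_trans; apply. Qed.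

Lemma ltn_rank (s : seq nat) (x y : nat) :
  x \in s -> (rank s x < rank s y)%N = (x < y)%N.
Proof.
move=> xs; have [xy|yx] := ltnP x y; last by rewrite ltnNge leq_rank.
rewrite /rank !(permP (perm_to_rem xs)) /= ltnn xy ltnS.
by apply: sub_count => z /= /ltn_trans; apply.
Qed.

Lemma rank_inj (s : seq nat) : {in s &, injective (rank s)}.
Proof.
move=> x y xs ys rank_xy; case: (ltngtP x y) => //.
  by rewrite -(ltn_rank _ xs) rank_xy ltnn.
by rewrite -(ltn_rank _ ys) rank_xy ltnn.
Qed.

Lemma rank_lt_size (s : seq nat) (x : nat) : x \in s -> (rank s x < size s)%N.
Proof.
move=> xs; rewrite /rank (permP (perm_to_rem xs)) /= ltnn.
by rewrite (perm_size (perm_to_rem xs)) ltnS count_size.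
Qed.

Lemma order_isomorphic_mono (f : nat -> nat) (s : seq nat) :
  {in s &, {mono f : x y / (x < y)%N}} -> order_isomorphic (map f s) s.
Proof.
move=> f_mono; split; first by rewrite size_map.
move=> i j; rewrite size_map => si sj.
by rewrite !(nth_map 0%N)// f_mono ?mem_nth.
Qed.

Lemma order_isomorphic_uniq (s t : seq nat) :
  order_isomorphic s t -> uniq t -> uniq s.
Proof.
move=> [sz lt_st] t_uniq; apply/(uniqP 0%N) => i j /= si sj ij.
apply/eqP; rewrite -(nth_uniq 0%N _ _ t_uniq) -?sz//.
by rewrite eqn_leq leqNgt -lt_st// ij ltnn leqNgt -lt_st// ij ltnn.
Qed.

Lemma order_isomorphic_rank (s t : seq nat) (i : nat) :
  order_isomorphic s t -> (i < size s)%N ->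
  rank s (nth 0%N s i) = rank t (nth 0%N t i).
Proof.
move=> [sz lt_st] si; rewrite /rank -!sum1_count.
rewrite (big_nth 0%N) [RHS](big_nth 0%N) -sz !big_mkord.
by apply: eq_bigl => j; exact: lt_st.
Qed.

Lemma order_isomorphic_perm_eq (s t : seq nat) :
  order_isomorphic s t -> perm_eq s t -> s = t.
Proof.
move=> st perm_st; have [sz _] := st.
apply: (@eq_from_nth _ 0%N) => // i si; apply: (@rank_inj t).
- by rewrite -(perm_mem perm_st) mem_nth.
- by rewrite mem_nth -?sz.
by rewrite -(order_isomorphic_rank st si) /rank (permP perm_st).
Qed.

Lemma superpattern_subseq (k : nat) (v w : seq nat) :
  subseq v w -> superpattern k v -> superpattern k w.
Proof.
move=> vw sv s sk s1; have [u uv us] := sv s sk s1.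
by exists u => //; exact: subseq_trans vw.
Qed.

Definition word_letters (k : nat) (w : seq 'I_k) : seq nat :=
  [seq (val a).+1 | a <- w].

Lemma letter_inj (k : nat) : injective (fun a : 'I_k => (val a).+1).
Proof. by move=> a b [/val_inj]. Qed.

Lemma word_letters_superpattern (k : nat) (w : seq 'I_k) :
  (forall u : seq 'I_k, size u = k -> subseq u w) ->
  superpattern k (word_letters w).
Proof.
case: k w => [|k] w all_w s sk _.
  by exists [::]; [exact: sub0seq|rewrite (size0nil sk)].
pose u : seq 'I_k.+1 := [seq inord (rank s x) | x <- s].
exists (word_letters u); first by rewrite map_subseq// all_w// size_map.
rewrite [word_letters u](_ : _ = [seq (rank s x).+1 | x <- s]).
  by apply: order_isomorphic_mono => x y xs _; exact: ltn_rank.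
rewrite /word_letters -map_comp; apply/eq_in_map => x xs /=.
by rewrite inordK// -sk rank_lt_size.
Qed.

Lemma superpattern_perm (k : nat) (w p : seq 'I_k) :
  superpattern k (word_letters w) -> perm_eq p (enum 'I_k) -> subseq p w.
Proof.
move=> sup p_perm; have p_size : size p = k.
  by rewrite (perm_size p_perm) size_enum_ord.
have p_uniq : uniq p by rewrite (perm_uniq p_perm) enum_uniq.
have [||u /subseqP[m _ uE] u_iso] := sup (word_letters p).
- by rewrite size_map.
- by apply/allP => _ /mapP[a _ ->].
rewrite -map_mask in uE; set v := mask m w in uE.
suff -> : p = v by exact: mask_subseq.
have v_uniq : uniq v.
  rewrite -(map_inj_uniq (@letter_inj k)) -uE (order_isomorphic_uniq u_iso)//.
  by rewrite map_inj_uniq//; exact: letter_inj.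
apply: (inj_map (@letter_inj k)); rewrite -uE; apply/esym.
apply: (order_isomorphic_perm_eq u_iso); rewrite uE perm_map//.
have v_size : size v = size p by have := u_iso.1; rewrite uE !size_map.
have v_p : {subset v <= p} by move=> a _; rewrite (perm_mem p_perm) mem_enum.
apply: uniq_perm => //.
exact: (uniq_min_size v_uniq v_p (eq_leq (esym v_size))).2.
Qed.

Section WordProbability.
Variables (R : realFieldType) (T : finType).

Definition word_prob (n : nat) (Q : pred (seq T)) : R :=
  #|[pred w : n.-tuple T | Q w]|%:R / #|T|%:R ^+ n.

Lemma le_word_prob (n : nat) (Q Q' : pred (seq T)) :
  (forall w, Q w -> Q' w) -> word_prob n Q <= word_prob n Q'.
Proof.
move=> QQ'; rewrite ler_wpM2r ?invr_ge0 ?exprn_ge0// ler_nat.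
by apply: subset_leq_card; apply/fintype.subsetP => w; exact: QQ'.
Qed.

Lemma word_prob0 (Q : pred (seq T)) : word_prob 0 Q = (Q [::])%:R.
Proof.
rewrite /word_prob expr0 divr1 -sum1_card big_mkcond natr_sum.
rewrite (big_pred1 [tuple]) => [|w]; last exact/esym/eqP/tuple0.
by rewrite inE; case: (Q _).
Qed.

Lemma word_probS (n : nat) (Q : pred (seq T)) :
  word_prob n.+1 Q =
  #|T|%:R^-1 * \sum_a word_prob n (fun w => Q (a :: w)).
Proof.
rewrite /word_prob -mulr_suml mulrCA -invfM -exprS -natr_sum; congr (_%:R / _).
rewrite -sum1_card; under [RHS]eq_bigr do rewrite -sum1_card.
rewrite pair_big_dep/=.
rewrite (reindex (fun p : T * n.-tuple T => [tuple of p.1 :: p.2]))//.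
exists (fun w => (thead w, [tuple of behead w])) => [[a w]|w] _ /=.
  by rewrite theadE; congr pair; apply: val_inj.
by rewrite -tuple_eta.
Qed.

Lemma word_prob_le_supermartingale (S : Type) (step : S -> T -> S)
    (valid : S -> Prop) (Q : pred S) (V : nat -> S -> R) (n : nat) (u : S) :
  (forall u a, valid u -> valid (step u a)) ->
  (forall u, valid u -> (Q u)%:R <= V 0%N u) ->
  (forall n u, valid u ->
    #|T|%:R^-1 * (\sum_a V n (step u a)) <= V n.+1 u) ->
  valid u -> word_prob n (fun w => Q (foldl step u w)) <= V n u.
Proof.
move=> valid_step V0 VS; elim: n u => [|n IH] u u_valid.
  by rewrite word_prob0; exact: V0.
rewrite word_probS; apply: le_trans (VS n u u_valid).
by rewrite ler_wpM2l ?invr_ge0// ler_sum// => a _; apply: IH; exact: valid_step.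
Qed.

End WordProbability.

Lemma sumr_if_in (R : pzRingType) (T : finType) (A : {set T}) (x y : R) :
  \sum_(a : T) (if a \in A then x else y) =
  #|A|%:R * x + (#|T|%:R - #|A|%:R) * y.
Proof.
rewrite big_if/= !sumr_const -(cardsC A) addnC natrD addrK !mulr_natl.
by congr (_ *+ _ + _ *+ _); apply: eq_card => a; rewrite !inE.
Qed.

Section GeometricWaitingTimes.
Variables (R : realFieldType) (k : nat).

(* A letter of a [k]-letter alphabet is one of [m] given letters with
   probability [m / k]: the waiting time for this has mean [k / m] and variance
   at most [(k / m) ^+ 2]. *)
Definition wait_mean (rates : seq nat) : R := \sum_(m <- rates) k%:R / m%:R.

Definition wait_var (rates : seq nat) : R :=
  \sum_(m <- rates) (k%:R / m%:R) ^+ 2.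

Lemma wait_mean_ge0 (rates : seq nat) : 0 <= wait_mean rates.
Proof. by apply: sumr_ge0 => m _; exact: divr_ge0. Qed.

Lemma wait_var_ge0 (rates : seq nat) : 0 <= wait_var rates.
Proof. by apply: sumr_ge0 => m _; exact: sqr_ge0. Qed.

(* Bounds the second moment of [tau + x], where [tau] is the waiting time. *)
Definition wait_moment (rates : seq nat) (x : R) : R :=
  wait_var rates + (wait_mean rates + x) ^+ 2.

Lemma wait_moment_ge0 (rates : seq nat) (x : R) : 0 <= wait_moment rates x.
Proof. by rewrite addr_ge0 ?sqr_ge0 ?wait_var_ge0. Qed.

Lemma sqr_le_wait_moment (rates : seq nat) (x : R) :
  0 <= x -> x ^+ 2 <= wait_moment rates x.
Proof.
move=> x_ge0; have := wait_mean_ge0 rates; have := wait_var_ge0 rates.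
by rewrite /wait_moment; nra.
Qed.

Lemma wait_moment_step (m : nat) (rates : seq nat) (x : R) :
  (0 < k)%N -> (0 < m)%N ->
  k%:R^-1 * (m%:R * wait_moment rates (x + 1) +
    (k%:R - m%:R) * wait_moment (m :: rates) (x + 1)) <=
  wait_moment (m :: rates) x.
Proof.
move=> k_gt0 m_gt0; rewrite /wait_moment /wait_mean /wait_var !big_cons.
(* The bound [(k / m) ^+ 2] exceeds the variance of this stage by [k / m], which
   is lost when the stage ends, that is, with probability [m / k]. *)
rewrite -subr_ge0 [leRHS](_ : _ = 1) ?ler01//.
have kN0 : k%:R != 0 :> R by rewrite pnatr_eq0 -lt0n.
have mN0 : m%:R != 0 :> R by rewrite pnatr_eq0 -lt0n.
by field; rewrite kN0 mN0.
Qed.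

End GeometricWaitingTimes.

Section GeometricStages.
Variables (R : realFieldType) (T : finType) (S : Type).
Variables (step : S -> T -> S) (valid : S -> Prop) (finished : pred S).
Variable rates : S -> seq nat.
Hypothesis T_gt0 : (0 < #|T|)%N.
Hypothesis valid_step : forall u a, valid u -> valid (step u a).
Hypothesis finished_step : forall u a, finished u -> step u a = u.
Hypothesis finishedE : forall u, valid u -> finished u = nilp (rates u).
Hypothesis rates_step : forall u m ms, valid u -> rates u = m :: ms ->
  (0 < m)%N /\ exists2 A : {set T}, #|A| = m &
    forall a, rates (step u a) = if a \in A then ms else rates u.

Local Notation mean u := (wait_mean R #|T| (rates u)).
Local Notation var u := (wait_var R #|T| (rates u)).

(* [e] is the deviation [n - mean u] at the start; once finished, the chain is
   on the wrong side of its mean if and only if [e < 0]. *)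
Definition potential (e : R) (n : nat) (u : S) : R :=
  if finished u then (e < 0)%R%:R
  else wait_moment #|T| (rates u) (e - n%:R) / e ^+ 2.

Lemma potential_le (e : R) (n : nat) (u : S) : e != 0 -> valid u ->
  potential e n u <= wait_moment #|T| (rates u) (e - n%:R) / e ^+ 2.
Proof.
move=> eN0 u_valid; rewrite /potential; case: ifPn => // u_fin.
have e2_gt0 : 0 < e ^+ 2 by rewrite exprn_even_gt0.
case: ltP => e_lt0; last by rewrite divr_ge0 ?sqr_ge0 ?wait_moment_ge0.
rewrite ler_pdivlMr// mul1r; move: u_fin; rewrite finishedE// => /nilP ->.
rewrite /wait_moment /wait_mean /wait_var !big_nil !add0r.
by have : 0 <= n%:R :> R by []; nra.
Qed.

Lemma potential_step (e : R) (n : nat) (u : S) : e != 0 -> valid u ->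
  #|T|%:R^-1 * (\sum_a potential e n (step u a)) <= potential e n.+1 u.
Proof.
move=> eN0 u_valid; case: (boolP (finished u)) => u_fin.
  under eq_bigr do rewrite finished_step//.
  rewrite sumr_const -[X in _ * X]mulr_natl mulKf ?pnatr_eq0 -?lt0n//.
  by rewrite /potential u_fin.
rewrite [leRHS]/potential (negbTE u_fin).
move: (u_fin); rewrite finishedE//; case E : (rates u) => [//|m ms] _.
have [m_gt0 [A A_card A_rates]] := rates_step u_valid E.
pose W rs : R := wait_moment #|T| rs (e - n.+1%:R + 1) / e ^+ 2.
apply: (@le_trans _ _
    (#|T|%:R^-1 * \sum_a (if a \in A then W ms else W (m :: ms)))).
  rewrite ler_wpM2l ?invr_ge0// ler_sum// => a _.
  apply: le_trans (potential_le n eN0 (valid_step a u_valid)) _.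
  rewrite A_rates E /W (_ : e - n%:R = e - n.+1%:R + 1) -?natr1; last by ring.
  by case: ifP.
rewrite sumr_if_in A_card /W !mulrA -mulrDl mulrA.
by rewrite ler_wpM2r ?invr_ge0 ?sqr_ge0// wait_moment_step.
Qed.

(* The event is to be early when [n] lies below the mean, late when above. *)
Lemma geometric_stages_chebyshev (n : nat) (u : S) :
  valid u -> n%:R != mean u ->
  word_prob R n (fun w => finished (foldl step u w) == (n%:R < mean u)) <=
  var u / (n%:R - mean u) ^+ 2.
Proof.
move=> u_valid; rewrite -subr_eq0 -subr_lt0; set e := n%:R - mean u => eN0.
apply: (@le_trans _ _ (potential e n u)); last first.
  apply: le_trans (potential_le n eN0 u_valid) _.
  by rewrite /wait_moment [_ + (e - _)](_ : _ = 0) ?expr0n ?addr0// /e; ring.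
apply: (word_prob_le_supermartingale (valid := valid)
  (Q := fun u => finished u == (e < 0))) => // [v _|m v].
  rewrite /potential subr0; case: (finished v); first by case: (e < 0).
  case: ltP => [_|e_ge0]; first by rewrite divr_ge0 ?sqr_ge0 ?wait_moment_ge0.
  by rewrite ler_pdivlMr ?exprn_even_gt0// mul1r sqr_le_wait_moment.
by move=> v_valid; exact: potential_step.
Qed.

End GeometricStages.

Definition countdown (n : nat) : seq nat := rev (iota 1 n).

Lemma countdownS (n : nat) : countdown n.+1 = n.+1 :: countdown n.
Proof. by rewrite /countdown -(addn1 n) iotaD rev_cat addn1. Qed.

Lemma big_countdown (V : nmodType) (n : nat) (f : nat -> V) :
  \sum_(i <- countdown n) f i = \sum_(i < n) f i.+1.
Proof.
rewrite big_rev -(addn0 1%N) iotaDl big_map -[n in iota 0 n]subn0.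
by rewrite -/(index_iota 0 n) big_mkord.
Qed.

(* A collection of [m] letters goes through stages with [m], [m - 1], ..., [1]
   letters missing; [r j] is the size of the [j]-th collection from the end. *)
Definition collection_rates (r : nat -> nat) (c : nat) : seq nat :=
  flatten [seq countdown (r j) | j <- countdown c].

Lemma collection_ratesS (r : nat -> nat) (c : nat) :
  collection_rates r c.+1 = countdown (r c.+1) ++ collection_rates r c.
Proof. by rewrite /collection_rates countdownS. Qed.

Lemma big_collection_rates (V : nmodType) (r : nat -> nat) (c : nat)
    (f : nat -> V) :
  \sum_(m <- collection_rates r c) f m = \sum_(j < c) \sum_(i < r j.+1) f i.+1.
Proof.
rewrite big_flatten big_map big_countdown.
by under eq_bigr do rewrite big_countdown.
Qed.

Lemma setD1_notin (T : finType) (A : {set T}) (a : T) :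
  a \notin A -> A :\ a = A.
Proof.
by move=> aA; apply/finset.setDidPl; rewrite disjoint_sym disjoints1.
Qed.

(* [pending] counts the current collection; below, a collection of [S] completed
   by the letter [a] is followed by a collection of [next a S]. *)
Record collector (T : finType) := Collector {
  pending : nat;
  alphabet : {set T};
  missing : {set T} }.

Section Collector.
Variables (T : finType) (next : T -> {set T} -> {set T}).
Implicit Types u : collector T.

Definition collector_step u (a : T) : collector T :=
  if pending u is c.+1 then
    if missing u :\ a == finset.set0 then
      Collector c (next a (alphabet u)) (next a (alphabet u))
    else Collector c.+1 (alphabet u) (missing u :\ a)
  else u.

Definition collector_finished u : bool := pending u == 0%N.

Definition collects (c : nat) (S M : {set T}) (w : seq T) : bool :=
  collector_finished (foldl collector_step (Collector c S M) w).

Lemma collects0 (S M : {set T}) (w : seq T) : collects 0 S M w.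
Proof. by elim: w. Qed.

Lemma collects_cons (c : nat) (S M : {set T}) (a : T) (w : seq T) :
  collects c.+1 S M (a :: w) =
  if M :\ a == finset.set0 then collects c (next a S) (next a S) w
  else collects c.+1 S (M :\ a) w.
Proof. by rewrite /collects /= /collector_step /=; case: ifP. Qed.

Variable r : nat -> nat.
Hypothesis r_gt0 : forall c, (0 < r c.+1)%N.
Hypothesis card_next : forall c a (S : {set T}),
  #|S| = r c.+2 -> a \in S -> #|next a S| = r c.+1.

Definition collector_rates u : seq nat :=
  if pending u is c.+1 then countdown #|missing u| ++ collection_rates r c
  else [::].

Definition collector_valid u : Prop :=
  (0 < pending u)%N ->
  [/\ #|alphabet u| = r (pending u), missing u \subset alphabet u &
      missing u != finset.set0].

Lemma collector_valid_start (c : nat) (S : {set T}) :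
  #|S| = r c -> collector_valid (Collector c S S).
Proof. by case: c => [|c] S_card // _; split; rewrite // -card_gt0 S_card. Qed.

Lemma collector_valid_step u (a : T) :
  collector_valid u -> collector_valid (collector_step u a).
Proof.
case: u => -[//|c] S M /(_ isT)[/= S_card MS M_neq0].
rewrite /collector_step /=; case: ifPn => [Ma0|Ma0 _]; last first.
  by split; rewrite //= (fintype.subset_trans (subsetDl _ _)).
case: c S_card => [//|c] S_card; apply: collector_valid_start.
apply: card_next S_card _; apply: (fintype.subsetP MS).
by apply: contraNT M_neq0 => /setD1_notin <-.
Qed.

Lemma collector_finishedE u :
  collector_valid u -> collector_finished u = nilp (collector_rates u).
Proof.
case: u => -[//|c] S M /(_ isT)[_ _]; rewrite -card_gt0 /collector_rates /=.
by case: #|M| => // m _; rewrite countdownS.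
Qed.

Lemma collector_rates_step u m ms :
  collector_valid u -> collector_rates u = m :: ms ->
  (0 < m)%N /\ exists2 A : {set T}, #|A| = m &
    forall a, collector_rates (collector_step u a) =
      if a \in A then ms else collector_rates u.
Proof.
case: u => -[//|c] S M /(_ isT)[/= S_card MS M_neq0].
rewrite {1 3}/collector_rates /=; case M_card : #|M| => [|m'].
  by move: M_neq0; rewrite -card_gt0 M_card.
rewrite countdownS => -[<- <-]; split=> //; exists M => // a.
rewrite /collector_step /=.
have [aM|/setD1_notin ->] := boolP (a \in M); last first.
  by rewrite (negbTE M_neq0) /collector_rates /= M_card countdownS.
have Ma_card : #|M :\ a| = m' by move: M_card; rewrite (cardsD1 a) aM => -[].
rewrite -cards_eq0 Ma_card; case: eqP => [m'0|_]; last first.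
  by rewrite /collector_rates /= Ma_card.
have aS := fintype.subsetP MS _ aM.
rewrite m'0 /collector_rates /=; case: c S_card => [//|c] S_card.
by rewrite (card_next S_card aS) collection_ratesS.
Qed.

Lemma collects_chebyshev (R : realFieldType) (n c : nat) (S : {set T}) :
  (0 < #|T|)%N -> #|S| = r c ->
  n%:R != wait_mean R #|T| (collection_rates r c) ->
  word_prob R n (fun w => collects c S S w ==
    (n%:R < wait_mean R #|T| (collection_rates r c))) <=
  wait_var R #|T| (collection_rates r c) /
    (n%:R - wait_mean R #|T| (collection_rates r c)) ^+ 2.
Proof.
move=> T_gt0 S_card.
have <- : collector_rates (Collector c S S) = collection_rates r c.
  by case: c S_card => [//|c] S_card; rewrite collection_ratesS -S_card.
apply: (geometric_stages_chebyshev T_gt0 (valid := collector_valid)).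
- by move=> u a; exact: collector_valid_step.
- by move=> [[|c'] S' M'].
- exact: collector_finishedE.
- exact: collector_rates_step.
exact: collector_valid_start.
Qed.

End Collector.

(* A letter outside [M] has already occurred in the current collection, so only
   [s] is still to be found. *)
Lemma collects_all_words (T : finType) (c : nat) (M : {set T}) (w : seq T)
    (x : T) (s : seq T) :
  collects (fun=> id) c.+1 [set: T]%SET M w -> size s = c ->
  subseq (if x \in M then x :: s else s) w.
Proof.
elim: w c M x s => [//|a w IH] c M x s; rewrite collects_cons.
case: ifPn => [/eqP Ma0|_] coll_w s_size.
  have s_w : subseq s w.
    case: s s_size coll_w => [|y s] /= <- coll_w; first exact: sub0seq.
    by have := IH _ _ y s coll_w erefl; rewrite finset.in_setT.
  case: ifP => xM; last exact: subseq_trans s_w (subseq_cons _ _).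
  have := finset.in_set0 x; rewrite -Ma0 in_setD1 xM andbT => /negbFE/eqP ->.
  by rewrite /= eqxx.
have := IH c _ x s coll_w s_size; rewrite in_setD1.
case: eqVneq => [->|_] /= sub_w.
  case: ifP => _; first by rewrite /= eqxx.
  exact: subseq_trans sub_w (subseq_cons _ _).
exact: subseq_trans sub_w (subseq_cons _ _).
Qed.

Lemma perm_enum_setD1 (T : finType) (x : T) (A : {set T}) :
  x \in A -> perm_eq (x :: enum (A :\ x)) (enum A).
Proof.
move=> xA; apply: uniq_perm; rewrite ?enum_uniq//=.
  by rewrite mem_enum in_setD1 eqxx enum_uniq.
by move=> y; rewrite inE !mem_enum in_setD1; case: eqVneq => [->|].
Qed.

(* The adversary always requires next the letter that completes the current
   collection, that is, the one whose first further occurrence comes last. *)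
Lemma collects_perms (T : finType) (c : nat) (S M : {set T}) (w : seq T) :
  #|S| = c -> M != finset.set0 -> M \subset S ->
  (forall x p, x \in M -> perm_eq (x :: p) (enum S) -> subseq (x :: p) w) ->
  collects (fun a A => A :\ a) c S M w.
Proof.
elim: w c S M => [|a w IH] [|c] S M S_card M_neq0 MS perms_w;
  rewrite ?collects0//.
  have [x xM] := finset.set0Pn _ M_neq0.
  by have := perms_w x _ xM (perm_enum_setD1 (fintype.subsetP MS _ xM)).
rewrite collects_cons; case: ifPn => [Ma0|Ma_neq0]; last first.
  apply: IH => // [|x p]; first exact: fintype.subset_trans (subD1set _ _) MS.
  by rewrite in_setD1 => /andP[/negbTE xa xM] /(perms_w _ _ xM) /=; rewrite xa.
have aM : a \in M by apply: contraTT Ma0 => /setD1_notin ->.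
have aS := fintype.subsetP MS _ aM.
have Sa_card : #|S :\ a| = c by move: S_card; rewrite (cardsD1 a) aS => -[].
case: c Sa_card {S_card} => [|c] Sa_card; first exact: collects0.
apply: IH => // [|x p xSa xp]; first by rewrite -card_gt0 Sa_card.
have := perms_w a (x :: p) aM; rewrite /= eqxx; apply.
by rewrite (perm_trans _ (perm_enum_setD1 aS))// perm_cons.
Qed.

Lemma collects_superpattern (k : nat) (w : seq 'I_k) :
  collects (fun=> id) k [set: 'I_k]%SET [set: 'I_k]%SET w ->
  superpattern k (word_letters w).
Proof.
case: k w => [|k] w coll_w; apply: word_letters_superpattern => -[|x s]//.
  by rewrite sub0seq.
move=> [s_size]; have := collects_all_words x coll_w s_size.
by rewrite finset.in_setT.
Qed.

Lemma superpattern_collects (k : nat) (w : seq 'I_k) :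
  superpattern k (word_letters w) ->
  collects (fun a A => A :\ a) k [set: 'I_k]%SET [set: 'I_k]%SET w.
Proof.
case: k w => [|k] w sup_w; first exact: collects0.
apply: collects_perms => //; first by rewrite cardsT card_ord.
  by rewrite -card_gt0 cardsT card_ord.
by move=> x p _; rewrite enum_setT -enumT; exact: superpattern_perm.
Qed.

Local Notation harmonic_sum := (series harmonic).

Lemma series_harmonicE (R : numFieldType) (n : nat) :
  harmonic_sum n = \sum_(1 <= i < n.+1) i%:R^-1 :> R.
Proof. by rewrite seriesEnat big_add1. Qed.

Lemma series_harmonic_ge0 (R : numFieldType) (n : nat) :
  0 <= harmonic_sum n :> R.
Proof. by apply: sumr_ge0 => i _; exact: harmonic_ge0. Qed.

Lemma sum_series_harmonic (R : realFieldType) (n : nat) :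
  \sum_(j < n) harmonic_sum j.+1 = n.+1%:R * harmonic_sum n - n%:R :> R.
Proof.
elim: n => [|n IH].
  by rewrite big_ord0 seriesEnat/= big_geq// mulr0 subr0.
have nN0 : n%:R + 1 != 0 :> R by rewrite natr1 pnatr_eq0.
by rewrite big_ord_recr/= IH seriesSr /= -!natr1; field.
Qed.

Lemma sum_inv_sqr_le (R : realFieldType) (n : nat) :
  \sum_(i < n) (i.+1%:R ^+ 2)^-1 <= 2 :> R.
Proof.
case: n => [|n]; first by rewrite big_ord0.
apply: (@le_trans _ _ (2 - n.+1%:R^-1)); last by rewrite gerBl invr_ge0.
elim: n => [|n IH]; first by rewrite big_ord1 expr1n invr1; lra.
rewrite big_ord_recr/=; apply: (le_trans (lerD IH (lexx _))).
rewrite -!natr1.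
have : 0 < n%:R + 1 :> R by rewrite natr1 ltr0n.
move: (n%:R + 1) => x x_gt0; rewrite -subr_ge0.
rewrite [leRHS](_ : _ = x^-1 * (x + 1)^-1 ^+ 2); last by field; lra.
by rewrite mulr_ge0 ?exprn_ge0 ?invr_ge0//; lra.
Qed.

Lemma wait_mean_collection_rates (R : realFieldType) (k c : nat)
    (r : nat -> nat) :
  wait_mean R k (collection_rates r c) =
  k%:R * \sum_(j < c) harmonic_sum (r j.+1).
Proof.
rewrite /wait_mean big_collection_rates mulr_sumr; apply: eq_bigr => j _.
by rewrite seriesEord mulr_sumr.
Qed.

Lemma wait_var_collection_rates_le (R : realFieldType) (k c : nat)
    (r : nat -> nat) :
  wait_var R k (collection_rates r c) <= c%:R * (2 * k%:R ^+ 2).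
Proof.
rewrite /wait_var big_collection_rates mulr_natl -[c in leRHS]card_ord.
rewrite -sumr_const; apply: ler_sum => j _.
under eq_bigr do rewrite expr_div_n.
by rewrite -mulr_sumr mulrC ler_wpM2r ?sqr_ge0// sum_inv_sqr_le.
Qed.

Lemma ler_div_sqr (R : realFieldType) (x y z : R) :
  0 <= x -> 0 < y -> y <= z -> x / z ^+ 2 <= x / y ^+ 2.
Proof.
move=> x_ge0 y_gt0 yz; have z_gt0 := lt_le_trans y_gt0 yz.
rewrite ler_wpM2l// lef_pV2 ?posrE ?exprn_gt0//.
by rewrite lerXn2r// nnegrE ltW.
Qed.

Lemma ln_sub_le (R : realType) (x y : R) :
  0 < x -> 0 < y -> ln x - ln y <= (x - y) / y.
Proof.
move=> x_gt0 y_gt0; rewrite -ln_div ?posrE// mulrBl divff ?gt_eqF//.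
have xy_gt0 : 0 < x / y by exact: divr_gt0.
by rewrite -[X in ln X](subrKC 1) le_ln1Dx//; lra.
Qed.

Lemma ln_succ_sub_itv (R : realType) (n : nat) :
  n.+2%:R^-1 <= ln n.+2%:R - ln (n.+1%:R : R) <= n.+1%:R^-1.
Proof.
have succ_sub : n.+2%:R - n.+1%:R = 1 :> R.
  by rewrite -[n.+2%:R]natr1 addrC addKr.
apply/andP; split.
  rewrite -lerN2 opprB (le_trans (ln_sub_le _ _)) ?ltr0Sn//.
  by rewrite -opprB succ_sub mulN1r.
by have := ln_sub_le (ltr0Sn R n.+1) (ltr0Sn R n); rewrite succ_sub mul1r.
Qed.

Lemma euler_gamma_bounds (R : realType) (n : nat) : (0 < n)%N ->
  euler_gamma R <= harmonic_sum n - ln n%:R <= euler_gamma R + n%:R^-1.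
Proof.
case: n => // n _.
pose u (i : nat) : R := harmonic_sum i - ln i%:R.
have u_noninc : nonincreasing_seq [sequence u i.+1]_i.
  apply/nonincreasing_seqP => i; rewrite /u /= [harmonic_sum i.+2]seriesSr /=.
  have /andP[+ _] := ln_succ_sub_itv R i.
  by move: (ln _) (ln _) (i.+2%:R^-1) => x y z; lra.
have v_nondec : nondecreasing_seq (fun i => u i.+1 - i.+1%:R^-1).
  apply/nondecreasing_seqP => i; rewrite /u /= [harmonic_sum i.+2]seriesSr /=.
  have /andP[_] := ln_succ_sub_itv R i.
  by move: (ln _) (ln _) (i.+1%:R^-1) (i.+2%:R^-1) => x y z t; lra.
have u_ge i j : (i <= j)%N -> u i.+1 - i.+1%:R^-1 <= u j.+1.
  by move=> /v_nondec/le_trans; apply; rewrite gerBl invr_ge0.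
have u_cvg : cvgn [sequence u i.+1]_i.
  apply: nonincreasing_is_cvgn => //.
  by exists (u 1%N - 1%:R^-1) => _ [i _ <-]; exact: u_ge.
have -> : euler_gamma R = limn [sequence u i.+1]_i.
  rewrite /euler_gamma; under eq_fun do rewrite -series_harmonicE.
  by apply: cvg_lim => //; rewrite -cvg_shiftS.
apply/andP; split; first exact: nonincreasing_cvgn_ge.
rewrite -lerBlDr; apply: limr_ge => //.
by exists n => // i /= ni; exact: u_ge.
Qed.

Definition upper_mean (R : realFieldType) (k : nat) : R :=
  k%:R ^+ 2 * harmonic_sum k.

Definition lower_mean (R : realFieldType) (k : nat) : R :=
  k%:R ^+ 2 * (harmonic_sum k - 1).

Lemma wait_mean_cst_rates (R : realFieldType) (k : nat) :
  wait_mean R k (collection_rates (fun=> k) k) = upper_mean R k.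
Proof.
rewrite wait_mean_collection_rates sumr_const card_ord mulrnAr -mulr_natl.
by rewrite /upper_mean expr2 mulrA.
Qed.

Lemma lower_mean_le_wait_mean (R : realFieldType) (k : nat) :
  lower_mean R k <= wait_mean R k (collection_rates id k).
Proof.
rewrite wait_mean_collection_rates sum_series_harmonic -natr1 /lower_mean.
have := series_harmonic_ge0 R k; have : 0 <= k%:R :> R by [].
by nra.
Qed.

Section SuperpatternWords.
Variables (R : realFieldType) (k n : nat).
Hypothesis k_gt0 : (0 < k)%N.

Local Notation rates_mean r := (wait_mean R k (collection_rates r k)).

Lemma collects_setT_chebyshev (next : 'I_k -> {set 'I_k} -> {set 'I_k})
    (r : nat -> nat) :
  (forall c, (0 < r c.+1)%N) ->
  (forall c a (S : {set 'I_k}),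
     #|S| = r c.+2 -> a \in S -> #|next a S| = r c.+1) ->
  r k = k -> n%:R != rates_mean r ->
  word_prob R n (fun w => collects next k [set: 'I_k]%SET [set: 'I_k]%SET w ==
    (n%:R < rates_mean r)) <= 2 * k%:R ^+ 3 / (n%:R - rates_mean r) ^+ 2.
Proof.
move=> r_gt0 card_next rk n_mean.
have := collects_chebyshev (R := R) (n := n) r_gt0 card_next.
move=> /(_ k [set: 'I_k]%SET); rewrite card_ord cardsT card_ord => /(_ k_gt0).
move=> /(_ (esym rk) n_mean)/le_trans; apply.
rewrite ler_wpM2r ?invr_ge0 ?sqr_ge0//.
by apply: le_trans (wait_var_collection_rates_le _ _ _ _) _; rewrite exprS; lra.
Qed.

Lemma word_prob_superpattern_le :
  n%:R < lower_mean R k ->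
  word_prob R n (fun w : seq 'I_k => `[< superpattern k (word_letters w) >]) <=
  2 * k%:R ^+ 3 / (lower_mean R k - n%:R) ^+ 2.
Proof.
move=> n_mean; have mean_le := lower_mean_le_wait_mean R k.
have n_rates_mean : n%:R < rates_mean id by exact: lt_le_trans mean_le.
apply: (@le_trans _ _ (2 * k%:R ^+ 3 / (n%:R - rates_mean id) ^+ 2));
  last first.
  rewrite -(sqrrN (n%:R - rates_mean id)) opprB.
  by rewrite ler_div_sqr ?mulr_ge0 ?exprn_ge0 ?subr_gt0 ?lerD2r.
apply: le_trans _ (collects_setT_chebyshev (next := fun a A => A :\ a) (r := id)
  _ _ _ _) => //.
- apply: le_word_prob => w /asboolP/superpattern_collects.
  by rewrite n_rates_mean eqb_id.
- by move=> c a S + aS; rewrite (cardsD1 a) aS => -[].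
- by rewrite lt_eqF.
Qed.

Lemma word_prob_not_superpattern_le :
  upper_mean R k < n%:R ->
  word_prob R n
    (fun w : seq 'I_k => ~~ `[< superpattern k (word_letters w) >]) <=
  2 * k%:R ^+ 3 / (n%:R - upper_mean R k) ^+ 2.
Proof.
rewrite -wait_mean_cst_rates => n_mean.
apply: le_trans _ (collects_setT_chebyshev (next := fun=> id) (r := fun=> k)
  _ _ _ _) => //.
- apply: le_word_prob => w; rewrite ltNge (ltW n_mean) eqbF_neg.
  by apply: contra => /collects_superpattern/asboolP.
- by rewrite gt_eqF.
Qed.

End SuperpatternWords.

Lemma superpattern_mkseq (k : nat) (w : nat -> nat) (m n : nat) : (m <= n)%N ->
  superpattern k (mkseq w m) -> superpattern k (mkseq w n).
Proof.
move=> /subnKC <-; apply: superpattern_subseq.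
by rewrite /mkseq iotaD map_cat prefix_subseq.
Qed.

Lemma superpattern_time_lt (R : realType) (k : nat) (w : nat -> nat)
    (x : \bar R) : (superpattern_time R k w < x)%E ->
  exists2 n, (n%:R%:E < x)%E & superpattern k (mkseq w n).
Proof. by move=> /ereal_inf_lt[_ [n sup_n <-] nx]; exists n. Qed.

Lemma superpattern_time_le (R : realType) (k : nat) (w : nat -> nat) (n : nat) :
  (superpattern_time R k w <= n%:R%:E)%E = `[< superpattern k (mkseq w n) >].
Proof.
apply/idP/asboolP => [time_n|sup_n]; last by apply: ereal_inf_lbound; exists n.
have /superpattern_time_lt[m] : (superpattern_time R k w < n.+1%:R%:E)%E.
  by rewrite (le_lt_trans time_n)// lte_fin ltr_nat.
by rewrite lte_fin ltr_nat ltnS; exact: superpattern_mkseq.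
Qed.

Definition window_lower (R : realType) (k : nat) (omega : R) : R :=
  k%:R ^+ 2 * ln k%:R - (1 - euler_gamma R) * k%:R ^+ 2
    - omega * (k%:R `^ (3 / 2)).

Definition window_upper (R : realType) (k : nat) (omega : R) : R :=
  k%:R ^+ 2 * ln k%:R + euler_gamma R * k%:R ^+ 2 + omega * (k%:R `^ (3 / 2)).

Lemma window_lower_le (R : realType) (k : nat) (omega : R) : (0 < k)%N ->
  window_lower k omega <= lower_mean R k - omega * k%:R `^ (3 / 2).
Proof.
move=> k_gt0; have /andP[+ _] := euler_gamma_bounds R k_gt0.
move=> /(ler_wpM2l (sqr_ge0 k%:R)); rewrite /window_lower /lower_mean.
by move: (ln _) (series _ _) => l h; lra.
Qed.

Lemma le_window_upper (R : realType) (k : nat) (omega : R) : (0 < k)%N ->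
  upper_mean R k + (omega - 1) * k%:R `^ (3 / 2) <= window_upper k omega.
Proof.
move=> k_gt0; have k_ge1 : 1 <= k%:R :> R by rewrite ler1n.
have k_le_pow : k%:R <= k%:R `^ (3 / 2) :> R.
  by rewrite -[leLHS]powRr1 ?ler0n//; apply: ler_powR => //; lra.
have k2V : k%:R ^+ 2 * k%:R^-1 = k%:R :> R by rewrite expr2 mulfK//; lra.
have /andP[_ /(ler_wpM2l (sqr_ge0 k%:R))] := euler_gamma_bounds R k_gt0.
rewrite [leRHS]mulrDr k2V /window_upper /upper_mean.
by move: (ln _) (series _ _) k_le_pow => l h; lra.
Qed.

Section UniformLetters.
Variables (d : measure_display) (T : measurableType d) (R : realType).
Variables (P : probability T R) (k : nat) (X : nat -> {RV P >-> nat}).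

Local Notation prefix n t := (mkseq (X^~ t) n).
Local Notation X_time t := (superpattern_time R k (X^~ t)).

Lemma measurable_prefix (n : nat) (Q : seq nat -> Prop) :
  measurable [set t | Q (prefix n t)].
Proof.
elim: n Q => [|n IH] Q.
  have [Qnil|Qnil] := pselect (Q [::]).
    by rewrite (_ : mkset _ = setT)//; apply/seteqP; split.
  by rewrite (_ : mkset _ = set0)//; apply/seteqP; split.
rewrite (_ : mkset _ = \bigcup_a (X n @^-1` [set a] `&`
    [set t | Q (rcons (prefix n t) a)])).
  apply: bigcup_measurable => a _; apply: measurableI;
    last exact: (IH (fun v => Q (rcons v a))).
  exact: measurable_funPTI.
apply/seteqP; split => t /=; rewrite mkseqS.
  by move=> Qt; exists (X n t).
by move=> [a _ [/= -> ?]].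
Qed.

Hypotheses (k_gt0 : (0 < k)%N) (X_iid : iid_uniform_letters k X).

Lemma prob_prefix_eq (n : nat) (w : n.-tuple 'I_k) :
  P [set t | prefix n t = word_letters w] = (k%:R^-1 ^+ n)%:E.
Proof.
have [X_indep X_unif] := X_iid; set v := word_letters w.
have v_size : size v = n by rewrite size_map size_tuple.
have -> : [set t | prefix n t = v] =
    \bigcap_(i in [set` [fset i in iota 0 n]%fset]) X i @^-1` [set nth 0%N v i].
  apply/seteqP; split => t /=.
    move=> tv i /=; rewrite !inE mem_iota add0n => /andP[_ i_lt].
    by rewrite -tv nth_mkseq.
  move=> Xv; apply: (@eq_from_nth _ 0%N) => [|i]; rewrite size_mkseq ?v_size//.
  by move=> i_lt; rewrite nth_mkseq// Xv//= !inE mem_iota.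
rewrite X_indep// (eq_big_seq (fun=> (k%:R^-1)%:E)) => [|i].
  rewrite prodEFin big_const_seq count_predT card_fseq undup_id ?iota_uniq//.
  by rewrite size_iota -Monoid.iteropE.
rewrite !inE mem_iota add0n => /andP[_ i_lt]; apply: X_unif.
have /mapP[a _ ->] : nth 0%N v i \in v by rewrite mem_nth ?v_size.
exact: ltn_ord.
Qed.

Lemma prob_prefix_in (n : nat) (D : pred (n.-tuple 'I_k)) :
  P (\bigcup_(w in [set` D]) [set t | prefix n t = word_letters w]) =
  (#|D|%:R / k%:R ^+ n)%:E.
Proof.
rewrite [in LHS](_ : [set` D] = [set` enum D]); last first.
  by apply/seteqP; split => w /=; rewrite mem_enum.
rewrite measure_fin_bigcup//=.
- rewrite -fsbig_seq ?enum_uniq//.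
  rewrite (eq_bigr (fun=> (k%:R^-1 ^+ n)%:E)) => [|w _]; last first.
    exact: prob_prefix_eq.
  rewrite sumEFin big_const_seq count_predT -cardE iter_addr addr0.
  by rewrite exprVn mulr_natl.
- by move=> v w _ _ [t [/= -> /(inj_map (@letter_inj k))/val_inj]].
- by move=> w _; exact: (measurable_prefix n (eq^~ _)).
Qed.

Lemma prob_prefix (n : nat) (Q : pred (seq nat)) :
  P [set t | Q (prefix n t)] =
  (word_prob R n (fun w : seq 'I_k => Q (word_letters w)))%:E.
Proof.
pose spelled := \bigcup_(w in [set: n.-tuple 'I_k])
  [set t | prefix n t = word_letters w].
have m_prefix := measurable_prefix n.
have spelled_m : measurable spelled.
  apply: fin_bigcup_measurable => // w _; exact: (m_prefix (eq^~ _)).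
have not_spelled : P (~` spelled) = 0%E.
  rewrite probability_setC// /spelled (_ : setT = [set` predT]); last first.
    by apply/seteqP; split.
  rewrite prob_prefix_in card_tuple card_ord natrX divff ?subee//.
  by rewrite expf_neq0// pnatr_eq0 -lt0n.
rewrite (measureDI _ (m_prefix Q) spelled_m).
rewrite (subset_measure0 _ _ _ not_spelled); last 3 first.
- exact: measurableD (m_prefix Q) spelled_m.
- exact: measurableC.
- by move=> t [].
rewrite add0e /word_prob card_ord -prob_prefix_in; congr (P _).
apply/seteqP; split => t /=.
  by move=> [Qt [w _ tw]]; exists w => //=; rewrite inE -tw.
by move=> [w /= Qw tw]; split; [rewrite tw|exists w].
Qed.

Lemma measurable_superpattern_time :
  measurable_fun [set: T] (fun t => superpattern_time R k (X^~ t) : \bar R).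
Proof.
pose time_at n t : \bar R :=
  if `[< superpattern k (prefix n t) >] then n%:R%:E else +oo%E.
rewrite (_ : (fun t => _) = fun t => einfs (time_at^~ t) 0); last first.
  apply/funext => t; apply/le_anti/andP; split.
    apply: le_ereal_inf_tmp => _ [n _ <-]; rewrite /time_at.
    case: asboolP => sup_n; last exact: leey.
    by apply: ereal_inf_lbound; exists n.
  apply: le_ereal_inf_tmp => _ [n sup_n <-]; apply: ereal_inf_lbound.
  by exists n => //; rewrite /time_at asboolT.
apply: measurable_fun_einfs => n; apply: measurable_fun_ifT => //.
apply: (measurable_fun_bool true).
rewrite setTI (_ : _ @^-1` _ = [set t | superpattern k (prefix n t)]).
  exact: (measurable_prefix n (superpattern k)).
by apply/seteqP; split => t /= /asboolP.
Qed.

Lemma measurable_superpattern_time_lt (x : \bar R) :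
  measurable [set t | (X_time t < x)%E].
Proof.
rewrite -[X in measurable X]setTI; apply: emeasurable_fun_infty_o => //.
exact: measurable_superpattern_time.
Qed.

Lemma measurable_superpattern_time_gt (x : \bar R) :
  measurable [set t | (x < X_time t)%E].
Proof.
rewrite -[X in measurable X]setTI; apply: emeasurable_fun_o_infty => //.
exact: measurable_superpattern_time.
Qed.

Lemma measurable_superpattern_time_le (x : \bar R) :
  measurable [set t | (X_time t <= x)%E].
Proof.
rewrite -[X in measurable X]setTI; apply: emeasurable_fun_infty_c => //.
exact: measurable_superpattern_time.
Qed.

Lemma prob_superpattern_time_le (n : nat) :
  n%:R < lower_mean R k ->
  (P [set t | X_time t <= n%:R%:E] <=
   (2 * k%:R ^+ 3 / (lower_mean R k - n%:R) ^+ 2)%:E)%E.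
Proof.
move=> n_mean; under eq_set do rewrite superpattern_time_le.
rewrite (prob_prefix _ (fun w => `[< superpattern k w >])) lee_fin.
exact: word_prob_superpattern_le.
Qed.

Lemma prob_superpattern_time_gt (n : nat) :
  upper_mean R k < n%:R ->
  (P [set t | n%:R%:E < X_time t] <=
   (2 * k%:R ^+ 3 / (n%:R - upper_mean R k) ^+ 2)%:E)%E.
Proof.
move=> n_mean; under eq_set do rewrite ltNge superpattern_time_le.
rewrite (prob_prefix _ (fun w => ~~ `[< superpattern k w >])) lee_fin.
exact: word_prob_not_superpattern_le.
Qed.

Lemma prob_superpattern_time_lt_lower_mean (x : R) : 0 < x ->
  (P [set t | X_time t < (lower_mean R k - x)%:E] <=
   (2 * k%:R ^+ 3 / x ^+ 2)%:E)%E.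
Proof.
set y := _ - x => x_gt0; have [y_lt0|y_ge0] := ltP y 0.
  rewrite (_ : mkset _ = set0); last first.
    apply/seteqP; split=> // t /= /superpattern_time_lt[n + _]; rewrite lte_fin.
    by move=> /(le_lt_trans (ler0n _ _))/lt_trans/(_ y_lt0); rewrite ltxx.
  by rewrite measure0 lee_fin divr_ge0 ?mulr_ge0 ?exprn_ge0// ltW.
have /andP[trunc_le _] := truncn_itv y_ge0; set n := Num.truncn y.
have x_le : x <= lower_mean R k - n%:R.
  by rewrite lerBrDr addrC -lerBrDr.
have n_mean : n%:R < lower_mean R k.
  by rewrite -subr_gt0 (lt_le_trans x_gt0).
apply: (@le_trans _ _ (P [set t | X_time t <= n%:R%:E])%E).
  apply: le_measure; first exact/mem_set/measurable_superpattern_time_lt.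
    exact/mem_set/measurable_superpattern_time_le.
  move=> t /= /superpattern_time_lt[m]; rewrite lte_fin => m_lt sup_m.
  rewrite superpattern_time_le; apply/asboolP/(superpattern_mkseq _ sup_m).
  by rewrite truncn_ge_nat// ltW.
apply: le_trans (prob_superpattern_time_le n_mean) _; rewrite lee_fin.
by rewrite ler_div_sqr ?mulr_ge0 ?exprn_ge0.
Qed.

Lemma prob_superpattern_time_gt_upper_mean (x : R) : 2 <= x ->
  (P [set t | (upper_mean R k + x)%:E < X_time t] <=
   (8 * k%:R ^+ 3 / x ^+ 2)%:E)%E.
Proof.
set y := _ + x => x_ge2; have y_ge0 : 0 <= y.
  have := series_harmonic_ge0 R k; have := sqr_ge0 (k%:R : R).
  by rewrite /y /upper_mean; nra.
have /andP[trunc_le] := truncn_itv y_ge0; set n := Num.truncn y in trunc_le *.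
rewrite -natr1 => trunc_gt.
have x_le : x / 2 <= n%:R - upper_mean R k.
  by move: trunc_gt; rewrite /y; lra.
have n_mean : upper_mean R k < n%:R by lra.
apply: (@le_trans _ _ (P [set t | n%:R%:E < X_time t])%E).
  apply: le_measure; first exact/mem_set/measurable_superpattern_time_gt.
    exact/mem_set/measurable_superpattern_time_gt.
  by move=> t /=; apply: le_lt_trans; rewrite lee_fin.
apply: le_trans (prob_superpattern_time_gt n_mean) _; rewrite lee_fin.
have -> : 8 * k%:R ^+ 3 / x ^+ 2 = 2 * k%:R ^+ 3 / (x / 2) ^+ 2 by field; lra.
by rewrite ler_div_sqr ?mulr_ge0 ?exprn_ge0//; lra.
Qed.

Lemma superpattern_time_itvC (x y : \bar R) :
  [set t | (x <= X_time t <= y)%E] =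
  ~` ([set t | (X_time t < x)%E] `|` [set t | (y < X_time t)%E]).
Proof.
apply/seteqP; split => t /=; rewrite !leNgt.
  by move=> /andP[/negP ? /negP ?] [].
by move=> /not_orP[/negP -> /negP ->].
Qed.

Lemma measurable_superpattern_time_itv (x y : \bar R) :
  measurable [set t | (x <= X_time t <= y)%E].
Proof.
rewrite superpattern_time_itvC; apply/measurableC/measurableU.
  exact: measurable_superpattern_time_lt.
exact: measurable_superpattern_time_gt.
Qed.

Lemma prob_superpattern_time_near_mean (x : R) : 2 <= x ->
  ((1 - 10 * k%:R ^+ 3 / x ^+ 2)%:E <=
   P [set t | (lower_mean R k - x)%:E <= X_time t <=
              (upper_mean R k + x)%:E])%E.
Proof.
move=> x_ge2; have x_gt0 : 0 < x by lra.
have := leeD (prob_superpattern_time_lt_lower_mean x_gt0)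
  (prob_superpattern_time_gt_upper_mean x_ge2).
rewrite -EFinD -!mulrDl -natrD superpattern_time_itvC => tails_le.
have early_m := measurable_superpattern_time_lt.
have late_m := measurable_superpattern_time_gt.
rewrite probability_setC; last exact: measurableU.
by rewrite EFinB leeB// (le_trans (measureU2 _ _ _) tails_le).
Qed.

Lemma prob_superpattern_time_window (omega : R) : 3 <= omega ->
  ((1 - 10 / (omega - 1) ^+ 2)%:E <=
   P [set t | (window_lower k omega)%:E <= X_time t <=
              (window_upper k omega)%:E])%E.
Proof.
move=> omega_ge3; set s := (k%:R : R) `^ (3 / 2).
have k_ge1 : 1 <= k%:R :> R by rewrite ler1n.
have s_ge1 : 1 <= s by rewrite -(powRr0 k%:R) ler_powR//; lra.
have s2 : s ^+ 2 = k%:R ^+ 3.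
  rewrite /s -powR_mulrn ?powR_ge0// -powRrM -powR_mulrn ?ler0n//.
  by congr powR; lra.
have dev_ge2 : 2 <= (omega - 1) * s by nra.
have -> : 10 / (omega - 1) ^+ 2 = 10 * k%:R ^+ 3 / ((omega - 1) * s) ^+ 2.
  by rewrite -s2; field; lra.
apply: le_trans (prob_superpattern_time_near_mean dev_ge2) _.
apply: le_measure; first exact/mem_set/measurable_superpattern_time_itv.
  exact/mem_set/measurable_superpattern_time_itv.
move=> t /= /andP[lower_t t_upper]; apply/andP; split.
  apply: le_trans lower_t; rewrite lee_fin.
  by apply: le_trans (window_lower_le omega k_gt0) _; rewrite -/s; lra.
by apply: le_trans t_upper _; rewrite lee_fin le_window_upper.
Qed.

End UniformLetters.

Lemma cvg_sub_div_sqr (R : realType) (u : nat -> R) (a : R) :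
  u k @[k --> \oo] --> +oo -> 1 - a / (u k - 1) ^+ 2 @[k --> \oo] --> (1 : R).
Proof.
move=> u_pinfty; rewrite -[X in _ --> X]subr0 -[X in _ - X](mulr0 a).
apply: cvgB; first exact: cvg_cst.
apply: cvgMl_tmp; apply/gtr0_cvgV0.
  near=> k; rewrite exprn_gt0// subr_gt0; near: k.
  exact: cvgry_gt.
apply: cvg_comp cvgr_expr2.
apply/cvgryPge => x; near=> k; rewrite lerBrDr; near: k.
exact: cvgry_ge.
Unshelve. all: by end_near. Qed.

Unset Implicit Arguments.

Theorem theorem5 (R : realType)
    (d : nat -> measure_display) (T : forall k : nat, measurableType (d k))
    (P : forall k : nat, probability (T k) R)
    (letter : forall k : nat, nat -> {RV (P k) >-> nat})
    (iid_letter : forall k : nat, (1 <= k)%N ->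
       iid_uniform_letters k (letter k))
    (omega : nat -> R) (omega_pinfty : omega k @[k --> \oo] --> +oo) :
  let X (k : nat) (t : T k) : \bar R :=
    superpattern_time R k (fun n => letter k n t) in
  let lower (k : nat) : R :=
    k%:R ^+ 2 * ln k%:R - (1 - euler_gamma R) * k%:R ^+ 2
      - omega k * (k%:R `^ (3 / 2)) in
  let upper (k : nat) : R :=
    k%:R ^+ 2 * ln k%:R + euler_gamma R * k%:R ^+ 2
      + omega k * (k%:R `^ (3 / 2)) in
  P k [set t : T k | ((lower k)%:E <= X k t <= (upper k)%:E)%E]
    @[k --> \oo] --> (1%R)%:E.
Proof.
move=> X lower upper.
apply: (squeeze_cvge (f := fun k => (1 - 10 / (omega k - 1) ^+ 2)%:E)
  (h := cst 1%:E)); last exact: cvg_cst.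
  near=> k; have k_gt0 : (0 < k)%N by near: k; exact: nbhs_infty_gt.
  have omega_ge3 : 3 <= omega k by near: k; exact: cvgry_ge.
  apply/andP; split; last first.
    exact/probability_le1/measurable_superpattern_time_itv.
  exact: (prob_superpattern_time_window k_gt0 (iid_letter k k_gt0)).
apply: cvg_EFin; first exact: nearW.
exact: cvg_sub_div_sqr.
Unshelve. all: by end_near. Qed.
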